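(* Let $p$ be an odd prime. Every finite $p$-abelian group has property $(\hat{s})$.
   Context: A finite $p$-group $G$ is called $p$-abelian if $(xy)^p=x^py^p$ for all $x,y\in G$. Let $F$ be a fixed algebraically closed field of characteristic $0$. For $A\in GL_n(F)$ let $\sigma(A)\subseteq F$ be its set of eigenvalues. A matrix group $\mathcal{G}\subseteq GL_n(F)$ has property $(s)$ if $\sigma(AB)\subseteq\sigma(A)\sigma(B)=\{\lambda\mu:\lambda\in\sigma(A),\mu\in\sigma(B)\}$ for all $A,B\in\mathcal{G}$. A finite group $G$ has property $(\hat{s})$ if for every subgroup $H\le G$ and every irreducible representation $\varrho:H\to GL_n(F)$ the matrix group $\varrho(H)$ has property $(s)$. *)

(* Defs.v *)
From HB Require Import structures.
From mathcomp Require Import all_boot all_order all_algebra.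
From mathcomp Require Import all_fingroup all_solvable all_field all_character.

Set Implicit Arguments.
Unset Strict Implicit.
Unset Printing Implicit Defensive.

Import GroupScope GRing.Theory.
Local Open Scope ring_scope.

Definition p_abelian (p : nat) (gT : finGroupType) (G : {group gT}) : Prop :=
  p.-group G /\
  {in G &, forall x y : gT, ((x * y) ^+ p = x ^+ p * y ^+ p)%g}.

Definition spectrum (F : fieldType) (n : nat) (A : 'M[F]_n) : F -> Prop :=
  fun lambda => eigenvalue A lambda.

Definition prod_set (F : fieldType) (S T : F -> Prop) : F -> Prop :=
  fun c => exists lambda mu, [/\ S lambda, T mu & c = lambda * mu].

(* Stated for an arbitrary family [M] of matrices; it is only applied to images
   of group representations, which are subgroups of GL_n(F). *)
Definition property_s (F : fieldType) (n : nat) (M : 'M[F]_n -> Prop) : Prop :=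
  forall A B : 'M[F]_n, M A -> M B ->
  forall c : F, spectrum (A *m B) c -> prod_set (spectrum A) (spectrum B) c.

Definition repr_image (F : fieldType) (gT : finGroupType) (H : {group gT})
    (n : nat) (rho : mx_representation F H n) : 'M[F]_n -> Prop :=
  fun A => exists2 h, h \in H & A = rho h.

(* [mx_irreducible] excludes the zero representation, so [n > 0] is implied. *)
Definition property_shat (F : fieldType) (gT : finGroupType)
    (G : {group gT}) : Prop :=
  forall (H : {group gT}) (n : nat) (rho : mx_representation F H n),
    H \subset G -> mx_irreducible rho -> property_s (repr_image rho).

(* Main.v *)
(** In a [p]-abelian [p]-group every [p]-th power is central, so in an
    irreducible representation every [A ^+ p] is scalar and the spectrum of [A]
    consists of [p]-th roots of one scalar.  Given [x], [y] and an eigenvalue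
    [c] of [rho (x * y)], restrict to [<<[set x; y]>>] and pass to an irreducible
    constituent in which [c] still occurs.  If the image is not scalar, some [z]
    is central modulo the scalars without being scalar, so that one of the
    generators, say [x], satisfies [z x = w x z] for a scalar [w <> 1].  As
    [x ^+ p] is central, [w] is a primitive [p]-th root of unity, and the
    spectrum of [x], being stable under [w], contains all [p]-th roots of the
    scalar [x ^+ p].  Hence [c / mu] is an eigenvalue of [x] for any eigenvalue
    [mu] of [y]. *)
Require Import Defs.
From HB Require Import structures.
From mathcomp Require Import all_boot all_order all_algebra.
From mathcomp Require Import all_fingroup all_solvable all_field all_character.

Set Implicit Arguments.
Unset Strict Implicit.
Unset Printing Implicit Defensive.

Import GroupScope GRing.Theory.
Local Open Scope ring_scope.

Lemma p_abelianS (p : nat) (gT : finGroupType) (G H : {group gT}) :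
  H \subset G -> p_abelian p G -> p_abelian p H.
Proof.
move=> sHG [pG pabG]; split; first exact: pgroupS pG.
by move=> x y Hx Hy; apply: pabG; apply: (subsetP sHG).
Qed.

(* Expanding [(x * y) ^+ p] and [(y * x) ^+ p] shows that [y ^+ p] commutes with
   [x ^+ p.-1], which generates [<[x]>]. *)
Lemma p_abelian_expg_central (p : nat) (gT : finGroupType) (G : {group gT}) :
  prime p -> p_abelian p G -> {in G &, forall x y, commute x (y ^+ p)%g}.
Proof.
move=> p_pr [pG pabG] x y Gx Gy.
have [q def_p] : {q | p = q.+1} by exists p.-1; rewrite prednK ?prime_gt0.
have expVM n (a b : gT) : ((a * b) ^+ n.+1 = a * (b * a) ^+ n * b)%g.
  elim: n => [|n IHn]; first by rewrite !expg1 expg0 mulg1.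
  by rewrite expgS IHn [in RHS]expgS !mulgA.
(* Cancel the outer [x] and [y] in [x * (y * x) ^+ q * y = x ^+ q.+1 * y ^+ q.+1]. *)
have yxq : ((y * x) ^+ q = x ^+ q * y ^+ q)%g.
  have := pabG x y Gx Gy; rewrite def_p expVM expgS expgSr !mulgA.
  by move/mulIg; rewrite -!mulgA; move/mulgI.
(* Here [(y * x) ^+ p] equals both [x ^+ q * y ^+ q * (y * x)] and [y ^+ p * x ^+ q * x]; the last
   [x] cancels. *)
have cxq : commute (x ^+ q)%g (y ^+ p)%g.
  have := pabG y x Gy Gx; rewrite def_p expgSr yxq [(x ^+ q.+1)%g]expgSr !mulgA.
  by move/mulIg; rewrite -mulgA -expgSr.
(* The order of [x] is a power of [p], and [0 < q < p]. *)
have co_xq : coprime #[x] q.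
  apply: (@pnat_coprime p); first exact: mem_p_elt Gx.
  have := prime_gt1 p_pr; rewrite def_p ltnS => q_gt0.
  by rewrite p'natE -?def_p // gtnNdvd // def_p.
have : x \in <[(x ^+ q)%g]>.
  by have:= generator_coprime x q; rewrite co_xq => /eqP <-; apply: cycle_id.
case/cycleP=> i ->; exact: (commute_sym (commuteX i (commute_sym cxq))).
Qed.

Section Spectrum.

Variables (F : fieldType) (gT : finGroupType) (G : {group gT}) (n : nat).
Variable rG : mx_representation F G n.

Lemma eigenvalue_submod (U : 'M_n) (modU : mxmodule rG U) (x : gT) (c : F) :
  x \in G -> eigenvalue (submod_repr modU x) c -> eigenvalue (rG x) c.
Proof.
move=> Gx /eigenvalueP[v vx nz_v]; apply/eigenvalueP; exists (val_submod v).
  by rewrite -(val_submodJ modU) // vx linearZ.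
by rewrite val_submod_eq0.
Qed.

Lemma eigenvalue_expg_scalar (x : gT) (a c : F) (k : nat) :
  x \in G -> rG (x ^+ k)%g = a%:M -> eigenvalue (rG x) c -> c ^+ k = a.
Proof.
move=> Gx xka /eigenvalueP[v vx nz_v].
have vxk : v *m rG (x ^+ k)%g = c ^+ k *: v.
  elim: (k) => [|j IHj]; first by rewrite repr_mx1 mulmx1 scale1r.
  by rewrite expgSr repr_mxM ?groupX // mulmxA IHj -scalemxAl vx scalerA exprSr.
apply/eqP; rewrite -subr_eq0; have /eqP : (c ^+ k - a) *: v = 0.
  by rewrite scalerBl -vxk xka mul_mx_scalar subrr.
by rewrite scaler_eq0 (negPf nz_v) orbF.
Qed.

(* [x] is conjugate to [w *: x], so its spectrum is stable under [w]. *)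
Lemma eigenvalue_commutator_stable (x z : gT) (w c : F) (i : nat) :
  x \in G -> z \in G -> rG z *m rG x = w *: (rG x *m rG z) ->
  eigenvalue (rG x) c -> eigenvalue (rG x) (w ^+ i * c).
Proof.
move=> Gx Gz zx; elim: i => [|i IHi] ev_c; first by rewrite mul1r.
have /eigenvalueP[v vx nz_v] := IHi ev_c.
apply/eigenvalueP; exists (v *m rG z).
  by rewrite -mulmxA zx -scalemxAr mulmxA vx -scalemxAl scalerA mulrA -exprS.
apply: contraNneq nz_v => vz0.
by rewrite -[v](repr_mxK rG Gz) vz0 mul0mx.
Qed.

(* A preimage of a central element of [G / rcenter rG]. *)
Lemma pgroup_second_rcenter (p : nat) :
  p.-group G -> ~~ (G \subset rcenter rG) ->
  exists z, [/\ z \in G, z \notin rcenter rG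
    & forall y, y \in G -> exists w, rG z *m rG y = w *: (rG y *m rG z)].
Proof.
move=> pG ntG; have nZG := rcenter_normal rG.
have nilQ : nilpotent (G / rcenter rG) by apply: pgroup_nil (quotient_pgroup _ pG).
have : 'Z(G / rcenter rG) != 1%g.
  by rewrite center_nil_eq1 // -subG1 quotient_sub1 ?normal_norm.
case/trivgPn=> zb /setIP[/morphimP[z Nz Gz ->] cz] ntz.
exists z; split=> //; first by apply: contra ntz => Zz; rewrite /= coset_id.
move=> y Gy; have Ny := subsetP (normal_norm nZG) y Gy.
(* Since [z * y = y * z * [~ z, y]], the scalar by which this commutator acts is the required
   [w]. *)
have : [~ z, y] \in rcenter rG.
  rewrite coset_idr ?groupR // morphR //; apply/eqP/commgP.
  exact: (centP cz) (mem_morphim _ Ny Gy).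
rewrite inE groupR //= => /is_scalar_mxP[w zyw]; exists w.
rewrite -!repr_mxM // [(z * y)%g]commgC.
by rewrite [LHS]repr_mxM ?groupR ?groupM // zyw mul_mx_scalar.
Qed.

End Spectrum.

(** Maschke's theorem gives a direct sum of simple submodules. By uniqueness of the decomposition,
    each component [u i] of an eigenvector satisfies the same eigenvector equation, and some
    component is nonzero. *)
Lemma eigenvalue_constituent (F : decFieldType) (gT : finGroupType)
    (G : {group gT}) (n : nat) (rG : mx_representation F G n) (x : gT) (c : F) :
  [pchar F]^'.-group G -> x \in G -> eigenvalue (rG x) c ->
  exists (U : 'M_n) (modU : mxmodule rG U),
    mx_irreducible (submod_repr modU) /\ eigenvalue (submod_repr modU x) c.
Proof.
move=> charG Gx /eigenvalueP[v vx nz_v].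
have redG := mx_Maschke_pchar rG charG.
have [I U W simU defW dxW] := dec_mx_reducible_semisimple (mxmodule1 rG) redG.
have modU i := mxsimple_module (simU i).
have [u Uu def_v _] : sub_dsumsmx_spec predT v U.
  by apply: sub_dsumsmx; rewrite ?defW ?submx1.
have [w _ _ uniq_w] : sub_dsumsmx_spec predT (c *: v) U.
  by apply: sub_dsumsmx; rewrite ?defW ?submx1.
have ux i : u i *m rG x = c *: u i.
  transitivity (w i).
    apply: (uniq_w (fun i => u i *m rG x)) => // [j _|].
      by rewrite (mxmodule_trans (modU j)) ?Uu.
    by rewrite -vx def_v mulmx_suml.
  symmetry; apply: (uniq_w (fun i => c *: u i)) => // [j _|].
    by rewrite scalemx_sub ?Uu.
  by rewrite def_v scaler_sumr.
have [i nz_ui] : exists i, u i != 0.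
  apply/existsP; apply: contraR nz_v => /existsPn u0.
  by rewrite def_v big1 // => i _; apply/eqP; rewrite -[_ == _]negbK u0.
exists (U i), (modU i); split; first exact/submod_mx_irr.
apply/eigenvalueP; exists (in_submod (U i) (u i)).
  by rewrite -in_submodJ ?Uu // ux linearZ.
by apply: contraNneq nz_ui => u0; rewrite -[u i](in_submodK (Uu i isT)) u0 linear0.
Qed.

Lemma closed_eigenvalue_exists (F : closedFieldType) (n : nat) (A : 'M[F]_n) :
  (n > 0)%N -> exists a, eigenvalue A a.
Proof.
move=> n_gt0.
have [|a ra] := closed_rootP (char_poly A) _; last first.
  by exists a; rewrite eigenvalue_root_char.
by rewrite size_char_poly eqSS -lt0n.
Qed.

Section IrreducibleSpectrum.

Variables (F : closedFieldType) (gT : finGroupType) (G : {group gT}) (n : nat).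
Variable rG : mx_representation F G n.
Hypothesis irrG : mx_irreducible rG.

(** Schur's lemma: over an algebraically closed field irreducibility is absolute. *)
Lemma repr_cent_scalar (x : gT) :
  x \in G -> (forall y, y \in G -> rG x *m rG y = rG y *m rG x) ->
  exists a, rG x = a%:M.
Proof.
move=> Gx cxG; apply/is_scalar_mxP/(mx_abs_irr_cent_scalar (rG := rG)).
  exact: group_closure_closed_field.
exact/centgmxP.
Qed.

Lemma full_spectrum (p : nat) (x z : gT) (a w c : F) :
  prime p -> x \in G -> z \in G -> rG (x ^+ p)%g = a%:M -> w != 1 ->
  rG z *m rG x = w *: (rG x *m rG z) -> c ^+ p = a -> eigenvalue (rG x) c.
Proof.
move=> p_pr Gx Gz xpa nt_w zx cpa.
have n_gt0 : (n > 0)%N by case/mx_irrP: irrG.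
have zxi i : rG z *m rG (x ^+ i)%g = w ^+ i *: (rG (x ^+ i)%g *m rG z).
  elim: i => [|i IHi]; first by rewrite repr_mx1 mulmx1 mul1mx scale1r.
  rewrite expgSr repr_mxM ?groupX // mulmxA IHi -scalemxAl -mulmxA zx.
  by rewrite -scalemxAr scalerA -exprSr mulmxA.
have nz_a : a != 0.
  apply: contraTneq (repr_mx_unit rG (groupX p Gx)) => a0.
  by rewrite xpa a0 unitmxE det_scalar expr0n eqn0Ngt n_gt0 unitr0.
(* [rG z] commutes with the nonzero scalar [rG (x ^+ p)], while moving it past [p] factors [rG x]
   produces [w ^+ p]. *)
have wp1 : w ^+ p = 1.
  have := zxi p; rewrite xpa mul_mx_scalar mul_scalar_mx scalerA => /eqP.
  rewrite -subr_eq0 -scalerBl scaler_eq0 => /orP[|/eqP z0].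
    by rewrite -{1}[a]mul1r -mulrBl mulf_eq0 (negPf nz_a) orbF subr_eq0 => /eqP<-.
  have := mxrank_unit (repr_mx_unit rG Gz).
  by rewrite z0 mxrank0 => n0; rewrite -n0 in n_gt0.
have w_prim : p.-primitive_root w.
  have [m m_prim] := prim_order_exists (prime_gt0 p_pr) wp1.
  case/(primeP p_pr).2/orP => /eqP def_m; last by rewrite -def_m.
  by have := prim_expr_order m_prim; rewrite def_m expr1 => w1; rewrite w1 eqxx in nt_w.
have [l ev_l] := closed_eigenvalue_exists (rG x) n_gt0.
have lp := eigenvalue_expg_scalar Gx xpa ev_l.
have nz_l : l != 0.
  by apply: contraNneq nz_a => l0; rewrite -lp l0 expr0n eqn0Ngt prime_gt0.
(* Both [c] and [l] are [p]-th roots of [a], so their quotient is a power of [w]. *)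
have [|i def_cl] := prim_rootP w_prim (x := c / l).
  by rewrite expr_div_n cpa lp divff.
rewrite -[c](divfK nz_l) def_cl.
exact: eigenvalue_commutator_stable zx ev_l.
Qed.

End IrreducibleSpectrum.

Lemma p_abelian_irr_eigenvalueM (F : closedFieldType) (p : nat)
    (gT : finGroupType) (x y : gT) (G := <<[set x; y]>>%G) (n : nat)
    (rG : mx_representation F G n) (c : F) :
  prime p -> p_abelian p G -> mx_irreducible rG ->
  eigenvalue (rG (x * y)%g) c ->
  exists l m, [/\ eigenvalue (rG x) l, eigenvalue (rG y) m & c = l * m].
Proof.
move=> p_pr pabG irrG ev_c.
have Gx : x \in G by rewrite mem_gen ?set21.
have Gy : y \in G by rewrite mem_gen ?set22.
have n_gt0 : (n > 0)%N by case/mx_irrP: irrG.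
have [pG pabM] := pabG.
have ev0 g l : g \in G -> eigenvalue (rG g) l -> l != 0.
  move=> Gg /eigenvalueP[v vg nz_v]; apply: contraNneq nz_v => l0.
  by rewrite -[v](repr_mxK rG Gg) vg l0 scale0r mul0mx.
(* If [x] acts as a scalar [a], then [rG (x * y)] is [a *: rG y]. *)
have [sGZ | ntG] := boolP (G \subset rcenter rG).
  have /setIdP[_ /is_scalar_mxP[a xa]] := subsetP sGZ x Gx.
  have ev_a : eigenvalue (rG x) a.
    have [l ev_l] := closed_eigenvalue_exists (rG x) n_gt0.
    by rewrite -(@eigenvalue_expg_scalar _ _ _ _ rG x a l 1 Gx) ?expr1.
  have nz_a := ev0 _ _ Gx ev_a.
  exists a, (c / a); split; rewrite ?[a * _]mulrC ?divfK //.
  have /eigenvalueP[v vxy nz_v] := ev_c; apply/eigenvalueP; exists v => //.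
  move: vxy; rewrite repr_mxM // xa mul_scalar_mx -scalemxAr => vy.
  by rewrite mulrC -scalerA -vy scalerA mulVf // scale1r.
have exp_scal g : g \in G -> exists a, rG (g ^+ p)%g = a%:M.
  move=> Gg; apply: repr_cent_scalar; rewrite ?groupX // => h Gh.
  by rewrite -!repr_mxM ?groupX // (p_abelian_expg_central p_pr pabG Gh Gg).
have [a xa] := exp_scal x Gx; have [b yb] := exp_scal y Gy.
(* This makes [c / m] a [p]-th root of [a] and [c / l] one of [b]. *)
have cp : c ^+ p = a * b.
  apply: eigenvalue_expg_scalar ev_c; rewrite ?groupM //.
  by rewrite pabM // repr_mxM ?groupX // xa yb scalar_mxM.
have [l ev_l] := closed_eigenvalue_exists (rG x) n_gt0.
have [m ev_m] := closed_eigenvalue_exists (rG y) n_gt0.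
have [nz_l nz_m] := (ev0 _ _ Gx ev_l, ev0 _ _ Gy ev_m).
have lp := eigenvalue_expg_scalar Gx xa ev_l.
have mp := eigenvalue_expg_scalar Gy yb ev_m.
have [z [Gz nZz zG]] := pgroup_second_rcenter pG ntG.
have [u zx] := zG x Gx; have [w zy] := zG y Gy.
have [u1 | nt_u] := eqVneq u 1; last first.
  exists (c / m), m; split; rewrite ?divfK //.
  apply: (full_spectrum irrG p_pr Gx Gz xa nt_u zx).
  by rewrite expr_div_n cp mp mulfK // -mp expf_neq0.
have [w1 | nt_w] := eqVneq w 1; last first.
  exists l, (c / l); split; rewrite ?[l * _]mulrC ?divfK //.
  apply: (full_spectrum irrG p_pr Gy Gz yb nt_w zy).
  by rewrite expr_div_n cp lp [a * b]mulrC mulfK // -lp expf_neq0.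
(* With [u = w = 1], [z] commutes with both generators in the image, so Schur's lemma makes [rG z]
   scalar. *)
case/negP: nZz; rewrite inE Gz.
apply: (mx_abs_irr_cent_scalar (group_closure_closed_field irrG)).
rewrite /centgmx gen_subG; apply/subsetP=> _ /set2P[]->; rewrite inE ?Gx ?Gy /=.
  by rewrite zx u1 scale1r.
by rewrite zy w1 scale1r.
Qed.

Theorem corollary5p2 (F : closedFieldType) (charF0 : [pchar F]%R =i pred0)
    (p : nat) (p_prime : prime p) (p_odd : odd p)
    (gT : finGroupType) (G : {group gT}) (pabG : p_abelian p G) :
  property_shat F G.
Proof.
move=> H n rho sHG _ A B [x Hx ->] [y Hy ->] c; rewrite /spectrum -repr_mxM //.
move=> ev_c; pose K := <<[set x; y]>>%G.
have sKH : K \subset H by rewrite gen_subG subUset !sub1set Hx.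
have Kx : x \in K by rewrite mem_gen ?set21.
have Ky : y \in K by rewrite mem_gen ?set22.
have charK : [pchar F]^'.-group K.
  by apply/pgroupP=> q _ _; rewrite inE /= charF0.
(* The restriction of [rho] to [K] may be reducible; eigenvalues found on a constituent are still
   eigenvalues of [rho]. *)
have [U [modU [irrU ev_cU]]] :=
  eigenvalue_constituent (rG := subg_repr rho sKH) charK (groupM Kx Ky) ev_c.
have pabK := p_abelianS (subset_trans sKH sHG) pabG.
have [l [m [ev_l ev_m ->]]] := p_abelian_irr_eigenvalueM p_prime pabK irrU ev_cU.
by exists l, m; split; [apply: (eigenvalue_submod Kx ev_l)
                      | apply: (eigenvalue_submod Ky ev_m) |].
Qed.
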